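(* Let $H$ be a complex Hilbert space with $\dim H \geq 2$, and let $\mathcal{A}$ be a unital standard operator algebra on $H$ such that $\mathcal{A}$ is closed under the adjoint operation. Suppose that $\varphi : \mathcal{A} \to \mathcal{A}$ is a linear map. Then the following conditions are equivalent: (i) $\varphi$ is a right centralizer, i.e. $\varphi(AB) = A\varphi(B)$ for all $A, B \in \mathcal{A}$; (ii) for all $A, B \in \mathcal{A}$, if $A^\star B = 0$ then $\varphi(A)^\star B = 0$.
   Context: All algebras and vector spaces are over the complex field $\mathbb{C}$. For a Hilbert space $H$, $B(H)$ denotes the algebra of all bounded linear operators on $H$, $F(H)$ the algebra of all finite rank operators in $B(H)$, $I$ the identity operator, and $A^\star$ the Hilbert space adjoint of $A \in B(H)$. A standard operator algebra on $H$ is any subalgebra of $B(H)$ which contains $F(H)$ (it need not be norm closed); unital means that it contains $I$. A linear map $\varphi : \mathcal{A} \to \mathcal{A}$ is a right centralizer if $\varphi(AB) = A\varphi(B)$ for all $A, B \in \mathcal{A}$. No continuity of $\varphi$ is assumed. *)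

(* Defs.v *)
From HB Require Import structures.
From mathcomp Require Import all_boot all_order all_algebra.
From mathcomp Require Import all_classical all_reals all_analysis.
From mathcomp Require Import complex.

Set Implicit Arguments.
Unset Strict Implicit.
Unset Printing Implicit Defensive.

Import Order.TTheory GRing.Theory Num.Theory.
Import numFieldNormedType.Exports.

Local Open Scope classical_set_scope.
Local Open Scope complex_scope.
Local Open Scope ring_scope.

(* The inner product is linear in its first argument and conjugate-linear in
   its second one; its norm is the norm for which the space is complete. *)
HB.mixin Record NormedModule_isHilbert (R : realType) H
    of CompleteNormedModule R[i] H := {
  hdot : {dot H for (@Num.conj R[i])} ;
  hdot_norm : forall x : H, `|x| ^+ 2 = hdot x x
}.

#[short(type="hilbertType")]
HB.structure Definition Hilbert (R : realType) :=
  {H of NormedModule_isHilbert R H & CompleteNormedModule R[i] H}.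

Definition linearly_independent (K : nzRingType) (V : lmodType K) n
    (e : 'I_n -> V) : Prop :=
  forall a : 'I_n -> K, \sum_i a i *: e i = 0 -> forall i, a i = 0.

Definition dim_ge (K : nzRingType) (V : lmodType K) (n : nat) : Prop :=
  exists e : 'I_n -> V, linearly_independent e.

Section Operators.
Variables (R : realType) (H : hilbertType R).
Local Notation C := R[i].

Definition bounded_op : set (H -> H) :=
  [set T | linear T /\ exists M : R, forall x, `|T x| <= M%:C * `|x|].

Definition finite_rank_op : set (H -> H) :=
  [set T | bounded_op T /\
    exists n (e : 'I_n -> H), forall x,
      exists a : 'I_n -> C, T x = \sum_i a i *: e i].

(* For a bounded T, Riesz representation gives exactly one such S. *)
Definition adjoint (T : H -> H) : H -> H :=
  get [set S | bounded_op S /\ forall x y, hdot (T x) y = hdot x (S y)].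

Record standard_operator_algebra (A : set (H -> H)) : Prop := {
  soa_bounded : A `<=` bounded_op ;
  soa_add : forall S T, A S -> A T -> A (S + T) ;
  soa_scale : forall (c : C) T, A T -> A (c *: T) ;
  soa_comp : forall S T, A S -> A T -> A (S \o T) ;
  soa_finite_rank : finite_rank_op `<=` A
}.

Definition unital (A : set (H -> H)) : Prop := A idfun.

Definition adjoint_closed (A : set (H -> H)) : Prop :=
  forall T, A T -> A (adjoint T).

(* A map of A into itself is given as an element of {fun A >-> A}; its values
   outside A play no role. *)
Definition linear_on (A : set (H -> H)) (phi : (H -> H) -> (H -> H)) : Prop :=
  forall (c : C) S T, A S -> A T -> phi (c *: S + T) = c *: phi S + phi T.

Definition right_centralizer (A : set (H -> H)) (phi : (H -> H) -> (H -> H)) :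
    Prop :=
  forall S T, A S -> A T -> phi (S \o T) = S \o phi T.

End Operators.

(* Main.v *)
(* Write [x (x) y] for the operator [rank_one x y] : z |-> <z, y> x.

   Let U = phi 1. If (i) holds then phi S = S U, and <S U v, T z> =
   <U v, S^* T z> yields (ii). Conversely, applying (ii) with T = w (x) w shows
   that w is orthogonal to the range of phi S as soon as it is orthogonal to the
   range of S. The map psi S = phi S - S U inherits this property and moreover
   kills 1. If <x, y> = 1, the range of 1 - x (x) y is orthogonal to y, which
   forces psi (x (x) y) = 0; by linearity psi kills all rank one operators.
   For any S and w, the component of S along w is the rank one operator
   w (x) S^*w up to a scalar, and removing it from S does not change psi S but
   makes the range orthogonal to w. Hence the range of psi S is orthogonal to
   every w.

   The adjoints exist by Riesz representation: a minimizing sequence for the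
   norm on the hyperplane f = 1 is Cauchy, and its limit is orthogonal to
   ker f. *)
Require Import Defs.
From HB Require Import structures.
From mathcomp Require Import all_boot all_order all_algebra.
From mathcomp Require Import all_classical all_reals all_analysis.
From mathcomp Require Import complex ring lra.

Set Implicit Arguments.
Unset Strict Implicit.
Unset Printing Implicit Defensive.

Import Order.TTheory GRing.Theory Num.Theory.
Import numFieldNormedType.Exports.

Local Open Scope classical_set_scope.
Local Open Scope complex_scope.
Local Open Scope ring_scope.

Lemma norm_small_eq0 (F : numFieldType) (z K : F) :
  0 <= K -> (forall e, 0 < e -> `|z| <= e * K) -> z = 0.
Proof.
move=> K0 zK; apply/eqP/negPn/negP; rewrite -normr_gt0 => z0.
have K1 : 0 < K + 1 by rewrite ltr_wpDl.
(* The [+ 1] keeps the divisor nonzero when [K] is zero. *)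
have := zK (`|z| / (K + 1)) (divr_gt0 z0 K1).
by rewrite mulrAC ler_pdivlMr// ler_pM2l// gerDl lt_geF.
Qed.

(** * Inner product geometry *)

Section InnerProduct.
Variables (R : realType) (H : hilbertType R).
Implicit Types (x y z : H) (c : R[i]).

Lemma hdotC x y : hdot x y = Num.conj (hdot y x).
Proof. by rewrite hermC expr0 mul1r. Qed.

Lemma hdotZl c x y : hdot (c *: x) y = c * hdot x y.
Proof. exact: linearZl_LR. Qed.

Lemma hdotZr c x y : hdot x (c *: y) = Num.conj c * hdot x y.
Proof. exact: linearZr_LR. Qed.

Lemma hdotDl x y z : hdot (x + y) z = hdot x z + hdot y z.
Proof. exact: linearDl. Qed.

Lemma hdotDr x y z : hdot x (y + z) = hdot x y + hdot x z.
Proof. exact: linearDr. Qed.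

Lemma hdotBl x y z : hdot (x - y) z = hdot x z - hdot y z.
Proof. exact: linearBl. Qed.

Lemma hdotBr x y z : hdot x (y - z) = hdot x y - hdot x z.
Proof. exact: linearBr. Qed.

Lemma hdot0l y : hdot 0 y = 0.
Proof. exact: linear0l. Qed.

Lemma hdot0r x : hdot x 0 = 0.
Proof. exact: linear0r. Qed.

Lemma hdot_eq0 x : (forall y, hdot y x = 0) -> x = 0.
Proof. by move=> /(_ x)/eqP; rewrite dnorm_eq0 => /eqP. Qed.

(** Pythagoras: the residual [u] is orthogonal to [y]. A lower bound on [hdot u u] thus bounds
    [hdot x y]: zero gives Cauchy-Schwarz, the minimum over a hyperplane gives
    near-orthogonality. *)
Lemma hdot_projection x y : y != 0 ->
  let u := x - (hdot x y / hdot y y) *: y in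
  hdot u u = hdot x x - `|hdot x y| ^+ 2 / hdot y y.
Proof.
move=> y0 /=; have yy0 : hdot y y != 0 by rewrite dnorm_eq0.
set c := hdot x y / hdot y y.
have uy : hdot (x - c *: y) y = 0 by rewrite hdotBl hdotZl divfK ?subrr.
rewrite hdotBr hdotZr uy mulr0 subr0 hdotBl hdotZl.
by rewrite [hdot y x]hdotC mulrAC -normCK.
Qed.

Lemma hdot_CauchySchwarz x y : `|hdot x y| <= `|x| * `|y|.
Proof.
have [->|y0] := eqVneq y 0; first by rewrite hdot0r !normr0 mulr0.
rewrite -ler_sqr ?nnegrE ?mulr_ge0// exprMn !hdot_norm.
by rewrite -ler_pdivrMr ?dnorm_gt0// -subr_ge0 -hdot_projection.
Qed.

Lemma hdot_parallelogram x y :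
  hdot (x + y) (x + y) + hdot (x - y) (x - y) = 2 * hdot x x + 2 * hdot y y.
Proof.
by rewrite dnormD dnormB addrACA subrr addr0 !mulr_natl !mulr2n addrACA.
Qed.

Lemma hdotE_Re x : (complex.Re (hdot x x))%:C = hdot x x.
Proof. by rewrite RRe_real// ger0_real// dnorm_ge0. Qed.

End InnerProduct.

(** * Riesz representation of bounded functionals *)

Section Riesz.
Variables (R : realType) (H : hilbertType R).
Variables (f : H -> R[i]) (M : R[i]).
Hypothesis f_scalar : scalar f.
Hypothesis f_bounded : forall x, `|f x| <= M * `|x|.

HB.instance Definition _ := GRing.isLinear.Build R[i] H R[i] _ f f_scalar.

Lemma minimizing_sequence : (exists x, f x != 0) ->
  exists (d : R) (u : nat -> H),
    [/\ forall x, f x = 1 -> d%:C <= hdot x x,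
        forall n, f (u n) = 1 &
        forall n, hdot (u n) (u n) <= (d + n.+1%:R^-1)%:C].
Proof.
move=> [x0 fx0].
pose E := [set complex.Re (hdot x x) | x in [set x | f x = 1]].
have lbE : lbound E 0.
  by move=> _ [x _ <-]; rewrite -ler0c hdotE_Re dnorm_ge0.
have infE : has_inf E.
  split; last by exists 0.
  eexists; exists ((f x0)^-1 *: x0); last by [].
  by rewrite /= linearZ /= mulVf.
have /choice[u uP] : forall n, exists x, f x = 1 /\
    hdot x x <= (inf E + n.+1%:R^-1)%:C.
  move=> n; have n0 : 0 < n.+1%:R^-1 :> R by rewrite invr_gt0.
  have [_ [x /= fx <-] xe] := inf_adherent n0 infE.
  by exists x; split=> //; rewrite -hdotE_Re lecR ltW.
exists (inf E), u; split=> [x fx|n|n]; try by have [] := uP n.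
by rewrite -hdotE_Re lecR ge_inf//; [exists 0|exists x].
Qed.

(* The midpoint of two points of the affine hyperplane [f = 1] lies in it, so
   the parallelogram law makes a minimizing sequence Cauchy. *)
Lemma almost_minimal_near (d a b : R) x y :
  (forall x, f x = 1 -> d%:C <= hdot x x) -> f x = 1 -> f y = 1 ->
  hdot x x <= (d + a)%:C -> hdot y y <= (d + b)%:C ->
  `|x - y| ^+ 2 <= (2 * a + 2 * b)%:C.
Proof.
move=> dmin fx fy xa yb; rewrite hdot_norm.
have mid : 4 * d%:C <= hdot (x + y) (x + y).
  have := dmin (2^-1 *: (x + y)).
  rewrite linearZ linearD /= fx fy -(mulr2n 1) mulVf ?pnatr_eq0// => /(_ erefl).
  rewrite dnormZ normfV ger0_norm ?ler0n// exprVn -natrX.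
  by rewrite ler_pdivlMl ?ltr0n.
have -> : hdot (x - y) (x - y) =
    2 * hdot x x + 2 * hdot y y - hdot (x + y) (x + y).
  by rewrite -hdot_parallelogram addrAC subrr add0r.
have -> : 2 * a + 2 * b = 2 * (d + a) + 2 * (d + b) - 4 * d by ring.
rewrite rmorphB rmorphD !rmorphM /= !rmorph_nat.
by rewrite lerB// lerD// ler_pM2l.
Qed.

(** Here [l] is the limit of a minimizing sequence. The excess is [e ^+ 2] because it will bound the
    square of an inner product. *)
Lemma approximate_minimizer : (exists x, f x != 0) ->
  exists (d : R) (l : H),
    (forall x, f x = 1 -> d%:C <= hdot x x) /\
    forall e : R, 0 < e -> exists x,
      [/\ f x = 1, hdot x x <= (d + e ^+ 2)%:C & `|l - x| <= e%:C].
Proof.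
move=> /minimizing_sequence[d [u [dmin fu du]]].
have invn (e : R) : 0 < e -> \forall n \near \oo, n.+1%:R^-1 < e.
  by move=> e0; exact: (near_infty_natSinv_lt (PosNum e0)).
have /cauchy_cvgP/cvg_ex[l ul] : cauchy (u @ \oo).
  apply: cauchy_exP => e e0.
  have e_real : (complex.Re e)%:C = e by rewrite RRe_real// gtr0_real.
  have Re0 : 0 < complex.Re e by rewrite -ltcR e_real.
  (* Excesses [a], [b] below a quarter of the squared radius keep [2 * a + 2 * b] below that
     square. *)
  have [|N _ NP] := invn (complex.Re e ^+ 2 / 4).
    by rewrite divr_gt0// exprn_gt0.
  exists (u N); exists N => // n /= Nn; rewrite -ball_normE /=.
  rewrite -ltr_sqr ?nnegrE// ?ltW//.
  apply: le_lt_trans (almost_minimal_near dmin (fu N) (fu n) (du N) (du n)) _.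
  rewrite -e_real -rmorphXn ltcR.
  have := NP n Nn; have := NP N (leqnn N) => /=.
  by move: N.+1%:R^-1 n.+1%:R^-1 (complex.Re e ^+ 2) => a b c; lra.
exists d, l; split=> // e e0.
have /cvgrPdist_lt/(_ e%:C) := ul; rewrite ltcR => /(_ e0) le.
near \oo => n; exists (u n); split => //.
- rewrite (le_trans (du n))// lecR lerD2l ltW//.
  near: n; apply: invn; exact: exprn_gt0.
- by rewrite ltW//; near: n.
Unshelve. all: by end_near. Qed.

Lemma riesz_representation : exists y, forall x, f x = hdot x y.
Proof.
have [fN0|/forallNP f0] := pselect (exists x, f x != 0); last first.
  by exists 0 => x; rewrite hdot0r; have /negP := f0 x; rewrite negbK => /eqP.
have [d [l [dmin lP]]] := approximate_minimizer fN0.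
(* [norm_small_eq0] wants a nonnegative constant, and [M] is an arbitrary complex number. *)
have f_le x : `|f x| <= `|M| * `|x|.
  rewrite -[X in _ * X]normr_id -normrM ger0_norm//.
  exact: le_trans (f_bounded x).
have approx e : 0 < e -> exists x,
    [/\ f x = 1, hdot x x <= d%:C + e ^+ 2 & `|l - x| <= e].
  move=> e0.
  have e_real : (complex.Re e)%:C = e by rewrite RRe_real// gtr0_real.
  have Re0 : 0 < complex.Re e by rewrite -ltcR e_real.
  have [x [fx xx lx]] := lP _ Re0; exists x.
  split => //; last by rewrite -e_real.
  by rewrite -e_real -rmorphXn -rmorphD.
have fl : f l = 1.
  apply/subr0_eq/(norm_small_eq0 (normr_ge0 M)) => e e0.
  have [x [fx _ lx]] := approx e e0.
  by rewrite -fx -linearB (le_trans (f_le _))// mulrC ler_wpM2r.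
have l_orth v : f v = 0 -> hdot v l = 0.
  move=> fv; have [->|v0] := eqVneq v 0; first exact: hdot0l.
  have vv0 : 0 < hdot v v by rewrite dnorm_gt0.
  have v2 : 0 <= `|v| + `|v| by rewrite addr_ge0.
  apply: (norm_small_eq0 v2) => e e0.
  have [x [fx xx lx]] := approx e e0.
  (* Removing from [x] its component along [v] stays on the hyperplane, as [f v = 0], so it lowers
     [hdot x x] by at most [e ^+ 2]. *)
  have xv : `|hdot x v| <= e * `|v|.
    rewrite -ler_sqr ?nnegrE ?mulr_ge0 ?(ltW e0)// exprMn hdot_norm.
    rewrite -ler_pdivrMr// -(lerD2l d%:C) (le_trans _ xx)// -lerBrDr.
    rewrite -hdot_projection//; apply: dmin.
    by rewrite linearB linearZ /= fv mulr0 subr0.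
  have -> : hdot v l = hdot v (l - x) + hdot v x by rewrite hdotBr subrK.
  rewrite (le_trans (ler_normD _ _))// mulrDr lerD//.
    by rewrite (le_trans (hdot_CauchySchwarz _ _))// mulrC ler_wpM2r.
  by rewrite hdotC norm_conjC.
have ll : hdot l l != 0.
  rewrite dnorm_eq0; apply/eqP => l0; move: fl.
  by rewrite l0 linear0 => /eqP; rewrite eq_sym oner_eq0.
(* Since [x - f x *: l] lies in the kernel, [hdot x l = f x * hdot l l]; the conjugate offsets
   conjugate-linearity in the second argument. *)
exists (Num.conj (hdot l l)^-1 *: l) => x.
have := l_orth (x - f x *: l).
rewrite linearB linearZ /= fl mulr1 subrr => /(_ erefl).
rewrite hdotBl hdotZl => /subr0_eq xl.
by rewrite hdotZr conjCK xl mulrC mulfK.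
Qed.

End Riesz.

(** * Adjoints and rank one operators *)

Section Operators.
Variables (R : realType) (H : hilbertType R).
Implicit Types (S T : H -> H) (x y z w : H).

(** The choice made by [get] is meaningful once a candidate exists; Riesz applied to [hdot (T x) y]
    as a functional of [x] supplies one. *)
Lemma adjointP T : bounded_op T ->
  bounded_op (adjoint T) /\
  forall x y, hdot (T x) y = hdot x (adjoint T y).
Proof.
move=> [T_lin [M TM]].
suff /getPex : exists S, bounded_op S /\
  forall x y, hdot (T x) y = hdot x (S y) by [].
have /choice[S TS] : forall y, exists s, forall x, hdot (T x) y = hdot x s.
  move=> y; apply: (@riesz_representation _ _ _ (M%:C * `|y|)).
    by move=> c u v; rewrite T_lin hdotDl hdotZl.
  move=> x; rewrite (le_trans (hdot_CauchySchwarz _ _))// mulrAC.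
  by rewrite ler_wpM2r.
have S_lin : linear S.
  move=> c u v; apply: subr0_eq; apply: hdot_eq0 => x.
  rewrite hdotBr hdotDr hdotZr -!TS hdotDr hdotZr.
  by rewrite subrr.
exists S; split => [|x y]; last exact: TS.
split=> //; exists M => y.
(* The bound [M] carries over: the square of the norm of [S y] is [hdot (T (S y)) y], and one factor
   cancels. *)
have [Sy0|Sy0] := eqVneq (S y) 0.
  by rewrite Sy0 normr0 (le_trans _ (TM y)).
rewrite -(ler_pM2r (_ : 0 < `|S y|)) ?normr_gt0//.
rewrite -expr2 -[leLHS]ger0_norm ?exprn_ge0// hdot_norm -TS mulrAC.
by rewrite (le_trans (hdot_CauchySchwarz _ _))// ler_wpM2r.
Qed.

Definition rank_one x y : H -> H := fun z => hdot z y *: x.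

Lemma rank_one_finite_rank x y : finite_rank_op (rank_one x y).
Proof.
split; last first.
  exists 1, (fun=> x) => z; exists (fun=> hdot z y).
  by rewrite big_ord_recl big_ord0 addr0.
split=> [c u v|]; first by rewrite /rank_one hdotDl hdotZl scalerDl scalerA.
exists (complex.Re (`|x| * `|y|)) => z.
rewrite RRe_real ?ger0_real ?mulr_ge0// normrZ mulrC -mulrA ler_wpM2l//.
by rewrite mulrC hdot_CauchySchwarz.
Qed.

(** * Linear maps that kill the identity and preserve orthogonality to ranges *)

Section RangeShrinking.
Variables (A : set (H -> H)) (psi : (H -> H) -> H -> H).
Hypothesis soaA : standard_operator_algebra A.
Hypothesis unitalA : unital A.
Hypothesis psi_lin : linear_on A psi.
Hypothesis psi_id : psi idfun = 0.
Hypothesis psi_range : forall S w, A S ->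
  (forall z, hdot (S z) w = 0) -> forall z, hdot (psi S z) w = 0.

Let rank_oneA x y : A (rank_one x y).
Proof. exact/(soa_finite_rank soaA)/rank_one_finite_rank. Qed.

Lemma range_shrinking_idempotent x y :
  hdot x y = 1 -> psi (rank_one x y) = 0.
Proof.
move=> xy; apply/funext => z; apply: hdot_eq0 => w.
have P_y : hdot (psi (rank_one x y) z) y = 0.
  have AIP : A (-1 *: rank_one x y + idfun).
    by apply: soa_add => //; apply: soa_scale.
  have := psi_range (w := y) AIP.
  rewrite psi_lin// psi_id addr0 => /(_ _ z).
  rewrite hdotZl mulN1r => P_y; apply: oppr_inj; rewrite oppr0; apply: P_y => u.
  by rewrite hdotDl hdotZl /rank_one hdotZl xy mulr1 mulN1r addNr.
(* The vector paired here is the part of [w] orthogonal to [x]; the rest of [w] is a multiple of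
   [y], handled by [P_y]. *)
have P_w : hdot (psi (rank_one x y) z) (w - Num.conj (hdot x w) *: y) = 0.
  apply: psi_range => // u.
  by rewrite /rank_one hdotZl hdotBr hdotZr conjCK xy mulr1 subrr mulr0.
move: P_w; rewrite hdotBr hdotZr P_y mulr0 subr0 => P_w.
by rewrite hdotC P_w rmorph0.
Qed.

Lemma range_shrinking_rank_one x y : psi (rank_one x y) = 0.
Proof.
have [->|y0] := eqVneq y 0.
  apply/funext => z; apply: hdot_eq0 => w; rewrite hdotC.
  by rewrite psi_range ?rmorph0// => u; rewrite /rank_one hdot0r scale0r hdot0l.
pose x0 := (hdot y y)^-1 *: y.
have x0y : hdot x0 y = 1 by rewrite hdotZl mulVf// dnorm_eq0.
(* This [c] makes [hdot (x - c *: x0) y = 1], so both summands below are idempotents. *)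
pose c := hdot x y - 1.
have -> : rank_one x y = c *: rank_one x0 y + rank_one (x - c *: x0) y.
  apply/funext => z.
  have -> : (c *: rank_one x0 y + rank_one (x - c *: x0) y) z =
    c *: (hdot z y *: x0) + hdot z y *: (x - c *: x0) by [].
  by rewrite scalerBr !scalerA (mulrC c) [RHS]addrC subrK.
rewrite psi_lin// !range_shrinking_idempotent ?scaler0 ?addr0//.
by rewrite hdotBl hdotZl x0y mulr1 /c opprB addrC subrK.
Qed.

Lemma range_shrinking_eq0 S : A S -> psi S = 0.
Proof.
move=> AS; apply/funext => z; apply: hdot_eq0 => w; rewrite hdotC.
have [->|w0] := eqVneq w 0; first by rewrite hdot0r rmorph0.
have [_ SS] := adjointP (soa_bounded soaA AS).
(* By adjointness [P u] is minus the projection of [S u] on the line of [w]. *)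
pose P := rank_one (- (hdot w w)^-1 *: w) (adjoint S w).
have AP : A P := rank_oneA _ _.
have <- : psi (1 *: P + S) = psi S.
  by rewrite psi_lin// /P range_shrinking_rank_one scaler0 add0r.
rewrite psi_range ?rmorph0//.
  by apply: soa_add => //; apply: soa_scale.
move=> u; rewrite hdotDl hdotZl mul1r /P /rank_one !hdotZl -SS.
by rewrite mulNr mulVf ?dnorm_eq0// mulrN1 addNr.
Qed.

End RangeShrinking.
End Operators.

Theorem theorem2p5 (R : realType) (H : hilbertType R)
    (A : set (H -> H)) (phi : {fun A >-> A}) :
  dim_ge H 2 ->
  standard_operator_algebra A -> unital A -> adjoint_closed A ->
  linear_on A phi ->
  right_centralizer A phi <->
  (forall S T : H -> H, A S -> A T ->
     adjoint S \o T = 0 -> adjoint (phi S) \o T = 0).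
Proof.
move=> _ soaA unitalA _ phi_lin.
have adjP S : A S -> forall x y, hdot (S x) y = hdot x (adjoint S y).
  by move=> /(soa_bounded soaA)/adjointP[].
split=> [phi_rc S T AS AT ST0|phi_perp].
  have phiS : phi S = S \o phi idfun by exact: (phi_rc S idfun).
  apply/funext => z; apply: hdot_eq0 => v.
  rewrite -adjP; last exact: funS.
  rewrite phiS /= adjP//.
  by have /(congr1 (@^~ z)) /= -> := ST0; exact: hdot0r.
(* Right composition with a fixed operator commutes with left composition. *)
suff phiE S : A S -> phi S = S \o phi idfun.
  by move=> S T AS AT; rewrite (phiE T AT) (phiE _ (soa_comp soaA AS AT)).
move=> AS; apply: subr0_eq.
apply: (@range_shrinking_eq0 _ _ A (fun S => phi S - (S \o phi idfun))) => //.
- move=> c U V AU AV; rewrite phi_lin//.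
  apply/funext => z; rewrite !fctE.
  by rewrite scalerBr opprD addrACA.
- exact: subrr.
- move=> {AS}S w AS Sw z.
  rewrite hdotBl [X in _ - X]Sw subr0.
  have ww : A (rank_one w w).
    exact/(soa_finite_rank soaA)/rank_one_finite_rank.
  have phiS_ww : adjoint (phi S) \o rank_one w w = 0.
    apply: phi_perp => //; apply/funext => u; apply: hdot_eq0 => v.
    by rewrite -adjP// hdotZr Sw mulr0.
  have [->|w0] := eqVneq w 0; first by rewrite hdot0r.
  (* At [w] the rank one operator returns [hdot w w *: w], a nonzero multiple of [w]. *)
  have : hdot (phi S z) (rank_one w w w) = 0.
    rewrite adjP; last exact: funS.
    rewrite -[adjoint _ _]/((adjoint (phi S) \o rank_one w w) w).
    by rewrite phiS_ww hdot0r.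
  rewrite hdotZr => /eqP.
  by rewrite mulf_eq0 conjC_eq0 dnorm_eq0 (negPf w0) => /eqP.
Qed.
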